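(* Let $\mathcal F=(F,<,+,\cdot,0,1,\ldots)$ be a definably complete, locally o-minimal expansion of an ordered field. Then $\mathcal F$ possesses the strong Banach fixed point property: every definable subset $E\subseteq F^n$ (for any $n$) which has the Banach fixed point property is closed in $F^n$.
   Context: ''Definable'' means definable in $\mathcal F$ with parameters. $\mathcal F$ is definably complete if every definable subset of $F$ has a supremum and an infimum in $F\cup\{\pm\infty\}$. $\mathcal F$ is locally o-minimal if for every $a\in F$ and every definable $X\subseteq F$ there is an open interval $I\ni a$ such that $X\cap I$ is a finite union of points and open intervals. $F^n$ carries the Euclidean norm $\|v\|$ and the induced topology. A definable contraction on a definable set $E\subseteq F^n$ is a definable map $h:E\to E$ for which there is $c\in F$ with $0\le c<1$ and $\|h(x)-h(y)\|\le c\|x-y\|$ for all $x,y\in E$. A definable set $E$ has the Banach fixed point property (BFPP) if every definable contraction on $E$ has a fixed point. $\mathcal F$ has the strong BFPP if every definable set having the BFPP is closed. *)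

(* Defs.v *)
From mathcomp Require Import all_boot all_order all_algebra.
From mathcomp Require Import boolp classical_sets constructive_ereal.

Set Implicit Arguments.
Unset Strict Implicit.
Unset Printing Implicit Defensive.

Import Order.TTheory GRing.Theory Num.Theory.
Local Open Scope ring_scope.
Local Open Scope classical_set_scope.

(* A structure (F, <, +, *, 0, 1, ...): the record holds the symbols denoted
   by the dots, of arbitrary cardinality and arities, with their
   interpretations.  F^n is 'rV[F]_n throughout. *)
Record expansion (F : realFieldType) := Expansion {
  fsym : Type;
  farity : fsym -> nat;
  finterp : forall s : fsym, 'rV[F]_(farity s) -> F;
  rsym : Type;
  rarity : rsym -> nat;
  rinterp : forall s : rsym, set 'rV[F]_(rarity s)
}.

(* First-order terms and formulas with parameters in F and free variables
   x_0, ..., x_(n-1).  The symbols 0 and 1 are instances of [Param].  The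
   quantifiers bind variable 0 of their body, whose variable i + 1 is the
   variable i of the quantified formula. *)
Inductive term (F : realFieldType) (M : expansion F) (n : nat) : Type :=
| Var of 'I_n
| Param of F
| Add of term M n & term M n
| Mul of term M n & term M n
| App (s : fsym M) of 'I_(farity s) -> term M n.

Inductive formula (F : realFieldType) (M : expansion F) (n : nat) : Type :=
| Eq of term M n & term M n
| Lt of term M n & term M n
| Rel (s : rsym M) of 'I_(rarity s) -> term M n
| Not of formula M n
| And of formula M n & formula M n
| Or of formula M n & formula M n
| Ex of formula M n.+1
| All of formula M n.+1.

Fixpoint eval (F : realFieldType) (M : expansion F) (n : nat)
    (x : 'rV[F]_n) (t : term M n) : F :=
  match t with
  | Var i => x ord0 i
  | Param a => a
  | Add t u => eval x t + eval x u
  | Mul t u => eval x t * eval x u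
  | App s ts => finterp (\row_i eval x (ts i))
  end.

Fixpoint holds (F : realFieldType) (M : expansion F) (n : nat)
    (f : formula M n) : set 'rV[F]_n :=
  match f with
  | Eq t u => fun x => eval x t = eval x u
  | Lt t u => fun x => eval x t < eval x u
  | Rel s ts => fun x => rinterp (\row_i eval x (ts i))
  | Not g => fun x => ~ holds g x
  | And g h => fun x => holds g x /\ holds h x
  | Or g h => fun x => holds g x \/ holds h x
  | Ex g => fun x => exists a : F, holds g (row_mx (const_mx a : 'rV_1) x)
  | All g => fun x => forall a : F, holds g (row_mx (const_mx a : 'rV_1) x)
  end.

Definition definable (F : realFieldType) (M : expansion F) (n : nat)
    (X : set 'rV[F]_n) : Prop :=
  exists f : formula M n, X = holds f.

Definition definable1 (F : realFieldType) (M : expansion F)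
    (X : set F) : Prop :=
  definable M [set x : 'rV[F]_1 | X (x ord0 ord0)].

Definition definably_complete (F : realFieldType) (M : expansion F) : Prop :=
  forall X : set F, definable1 M X ->
    (exists s : \bar F, supremums (EFin @` X) s) /\
    (exists i : \bar F, infimums (EFin @` X) i).

Definition open_interval (F : realFieldType) (a b : \bar F) : set F :=
  [set x | (a < x%:E)%E /\ (x%:E < b)%E].

Definition finite_union_points_intervals (F : realFieldType)
    (X : set F) : Prop :=
  exists (ps : seq F) (js : seq (\bar F * \bar F)),
    X = [set` ps] `|` \bigcup_(j in [set` js]) open_interval j.1 j.2.

Definition locally_ominimal (F : realFieldType) (M : expansion F) : Prop :=
  forall (a : F) (X : set F), definable1 M X ->
    exists l r : \bar F, open_interval l r a /\
      finite_union_points_intervals (X `&` open_interval l r).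

(* The nonnegative square root of the sum of the squares.  An ordered field
   need not have it, and then the value is the default 0; a definably complete
   expansion always does. *)
Definition enorm (F : realFieldType) (n : nat) (v : 'rV[F]_n) : F :=
  xget 0 [set r : F | 0 <= r /\ r ^+ 2 = \sum_(i < n) v ord0 i ^+ 2].

Definition enorm_open (F : realFieldType) (n : nat) (U : set 'rV[F]_n) : Prop :=
  forall x, U x ->
    exists2 e : F, 0 < e & forall y, enorm (y - x) < e -> U y.

Definition enorm_closed (F : realFieldType) (n : nat)
    (E : set 'rV[F]_n) : Prop := enorm_open (~` E).

(* Only the restriction of h to E matters: a map E -> E is represented by any
   total function extending it. *)
Definition definable_selfmap (F : realFieldType) (M : expansion F) (n : nat)
    (E : set 'rV[F]_n) (h : 'rV[F]_n -> 'rV[F]_n) : Prop :=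
  (forall x, E x -> E (h x)) /\
  definable M [set z : 'rV[F]_(n + n) |
                E (lsubmx z) /\ rsubmx z = h (lsubmx z)].

Definition definable_contraction (F : realFieldType) (M : expansion F)
    (n : nat) (E : set 'rV[F]_n) (h : 'rV[F]_n -> 'rV[F]_n) : Prop :=
  definable_selfmap M E h /\
  exists c : F, [/\ 0 <= c, c < 1 & forall x y, E x -> E y ->
    enorm (h x - h y) <= c * enorm (x - y)].

Definition BFPP (F : realFieldType) (M : expansion F) (n : nat)
    (E : set 'rV[F]_n) : Prop :=
  forall h : 'rV[F]_n -> 'rV[F]_n, definable_contraction M E h ->
    exists2 x, E x & h x = x.

Definition strong_BFPP (F : realFieldType) (M : expansion F) : Prop :=
  forall (n : nat) (E : set 'rV[F]_n),
    definable M E -> BFPP M E -> enorm_closed E.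

(* Main.v *)
(** Let [a] lie in the closure of [E] but not in [E], and let [rho] be the l1
    distance to [a]. By definable choice there is a definable curve [g] with
    [g t] in [E] and [rho (g t) = t] for all small [t > 0]. A definable
    function [f] with [|f t| <= t] is 2-Lipschitz near 0, because
    [2 t + f t] and [2 t - f t] lie between [t] and [3 t] and definable functions
    with that property are nondecreasing near 0. Hence
    [y |-> g (k * min (rho y) d)] is, for small [k] and [d], a definable
    contraction of [E]; it strictly decreases [rho], so it has no fixed point.

    For [u] definable with [t <= u t <= 3 t], monotonicity near 0 needs no
    general monotonicity theorem. By local o-minimality either all
    small [t] satisfy [u t <= u s] for every [s >= t], and we are done, or none
    does. If [u] is lower semicontinuous near 0, its minimum on [[t, 3 t]]
    is attained at a point of the excluded kind. Otherwise [u] fails to be lower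
    semicontinuous at every small [t]; but [u] has one-sided limits, so these
    failures die out to the right of each point, which is impossible by looking
    at record failures. *)
Require Import Defs.
From mathcomp Require Import all_boot all_order all_algebra.
From mathcomp Require Import boolp classical_sets constructive_ereal.
From mathcomp Require Import ring lra.

Set Implicit Arguments.
Unset Strict Implicit.
Unset Printing Implicit Defensive.

Import Order.TTheory GRing.Theory Num.Theory.

(** * Definability calculus *)

Section DefinabilityCalculus.
Local Open Scope ring_scope.
Variables (F : realFieldType) (M : expansion F).

(* Definability of a predicate on an arbitrary type [T] whose elements are
   read through coordinates [c : T -> F^k]; [c] need not be injective or
   surjective. Bound variables are then genuine Rocq variables. *)
Definition dpred (T : Type) (k : nat) (c : T -> 'rV[F]_k) (P : T -> Prop) :=
  exists f : formula M k, forall t, P t <-> holds f (c t).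

(** The new value comes first because the quantifiers of [formula] bind variable 0. *)
Definition ext (T : Type) (k : nat) (c : T -> 'rV[F]_k) (p : T * F) :
  'rV[F]_(1 + k) := row_mx (const_mx p.2) (c p.1).

Definition extv (T : Type) (k n : nat) (c : T -> 'rV[F]_k)
  (p : T * 'rV[F]_n) : 'rV[F]_(n + k) := row_mx p.2 (c p.1).

Definition coord1 (a : F) : 'rV[F]_1 := const_mx a.

Definition dfun (T : Type) (k : nat) (c : T -> 'rV[F]_k) (f : T -> F) :=
  dpred (ext c) (fun p => p.2 = f p.1).

(** * Substitution of terms *)

Lemma eval_subst n m (s : 'I_n -> term M m) (t : term M n) :
  exists u : term M m, forall x, eval x u = eval (\row_i eval x (s i)) t.
Proof.
elim: t => [i|a|t [u tu] t' [u' tu']|t [u tu] t' [u' tu']|g ts IH].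
- by exists (s i) => x /=; rewrite mxE.
- by exists (Param M m a).
- by exists (Add u u') => x /=; rewrite tu tu'.
- by exists (Mul u u') => x /=; rewrite tu tu'.
- have [us usP] := choice IH; exists (App us) => x /=.
  by congr (finterp _); apply/rowP => i; rewrite !mxE usP.
Qed.

Lemma holds_subst n (f : formula M n) m (s : 'I_n -> term M m) :
  exists g : formula M m, forall x,
    holds g x <-> holds f (\row_i eval x (s i)).
Proof.
(* Under a quantifier, variable 0 stays fixed and the images of the other variables are shifted by
   one. *)
have lift_subst k l (s' : 'I_k -> term M l) : exists s'' : 'I_k.+1 -> term M l.+1,
    forall a x, \row_i eval (row_mx (const_mx a : 'rV_1) x) (s'' i)
                = row_mx (const_mx a : 'rV_1) (\row_i eval x (s' i)).
  have /choice[w wP] (i : 'I_k) : exists u : term M (1 + l), forall a x,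
      eval (row_mx (const_mx a : 'rV_1) x) u = eval x (s' i).
    have [u uP] := eval_subst (fun j => Var M (rshift 1 j)) (s' i).
    exists u => a x; rewrite uP; congr (eval _ _).
    by apply/rowP => j; rewrite mxE /= row_mxEr.
  exists (fun i => match @split 1 k i with
                   | inl j => Var M (@lshift 1 l j) | inr j => w j end) => a x.
  apply/rowP => i; rewrite !mxE; case: (@split 1 k i) => j /=.
    by rewrite (@row_mxEl _ 1 1 l) !mxE.
  by rewrite wP mxE.
elim: f m s => {n}.
- move=> n t u m s; have [t' tP] := eval_subst s t; have [u' uP] := eval_subst s u.
  by exists (Eq t' u') => x /=; rewrite tP uP.
- move=> n t u m s; have [t' tP] := eval_subst s t; have [u' uP] := eval_subst s u.
  by exists (Lt t' u') => x /=; rewrite tP uP.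
- move=> n r ts m s; have [us usP] := choice (fun i => eval_subst s (ts i)).
  exists (Rel us) => x /=.
  suff -> : \row_i eval x (us i) = \row_i eval (\row_j eval x (s j)) (ts i) by [].
  by apply/rowP => i; rewrite !mxE usP.
- by move=> n g IH m s; have [g' gP] := IH m s; exists (Not g') => x /=; rewrite gP.
- move=> n g IHg h IHh m s; have [g' gP] := IHg m s; have [h' hP] := IHh m s.
  by exists (And g' h') => x /=; rewrite gP hP.
- move=> n g IHg h IHh m s; have [g' gP] := IHg m s; have [h' hP] := IHh m s.
  by exists (Or g' h') => x /=; rewrite gP hP.
- move=> n g IH m s; have [s' sP] := lift_subst _ _ s.
  have [g' gP] := IH _ s'; exists (Ex g') => x /=.
  by split=> -[a]; [rewrite gP sP | rewrite -sP -gP]; exists a.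
- move=> n g IH m s; have [s' sP] := lift_subst _ _ s.
  have [g' gP] := IH _ s'; exists (All g') => x /=.
  by split=> + a => /(_ a); rewrite gP sP.
Qed.

(** * Closure properties of definable predicates *)

Lemma eq_dpred T k (c : T -> 'rV[F]_k) (P Q : T -> Prop) :
  (forall t, P t <-> Q t) -> dpred c P -> dpred c Q.
Proof. by move=> PQ [f fP]; exists f => t; rewrite -PQ. Qed.

Lemma dpred_not T k (c : T -> 'rV[F]_k) P :
  dpred c P -> dpred c (fun t => ~ P t).
Proof. by move=> [f fP]; exists (Not f) => t /=; rewrite fP. Qed.

Lemma dpred_and T k (c : T -> 'rV[F]_k) P Q :
  dpred c P -> dpred c Q -> dpred c (fun t => P t /\ Q t).
Proof. by move=> [f fP] [g gP]; exists (And f g) => t /=; rewrite fP gP. Qed.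

Lemma dpred_or T k (c : T -> 'rV[F]_k) P Q :
  dpred c P -> dpred c Q -> dpred c (fun t => P t \/ Q t).
Proof. by move=> [f fP] [g gP]; exists (Or f g) => t /=; rewrite fP gP. Qed.

Lemma dpred_imp T k (c : T -> 'rV[F]_k) (P Q : T -> Prop) :
  dpred c P -> dpred c Q -> dpred c (fun t => P t -> Q t).
Proof.
move=> /dpred_not dP dQ; apply: eq_dpred (dpred_or dP dQ) => t.
by rewrite -implyE.
Qed.

Lemma dpred_ex T k (c : T -> 'rV[F]_k) (P : T -> F -> Prop) :
  dpred (ext c) (fun p => P p.1 p.2) -> dpred c (fun t => exists a, P t a).
Proof.
move=> [f fP]; exists (Ex f) => t /=.
by split=> -[a Pa]; exists a; apply/(fP (t, a)).
Qed.

Lemma dpred_all T k (c : T -> 'rV[F]_k) (P : T -> F -> Prop) :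
  dpred (ext c) (fun p => P p.1 p.2) -> dpred c (fun t => forall a, P t a).
Proof.
move=> [f fP]; exists (All f) => t /=.
by split=> Pa a; apply/(fP (t, a))/Pa.
Qed.

Lemma dpred_True T k (c : T -> 'rV[F]_k) : dpred c (fun=> True).
Proof. by exists (Eq (Param M k 0) (Param M k 0)) => t. Qed.

Lemma dpred_forall_fin T k (c : T -> 'rV[F]_k) n (P : T -> 'I_n -> Prop) :
  (forall i, dpred c (P^~ i)) -> dpred c (fun t => forall i, P t i).
Proof.
move=> dP; suff H (s : seq 'I_n) : dpred c (fun t => forall i, i \in s -> P t i).
  by apply: eq_dpred (H (enum 'I_n)) => t; split=> Pt i *; apply: Pt; rewrite ?mem_enum.
elim: s => [|i s IH]; first by apply: eq_dpred (dpred_True c).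
apply: eq_dpred (dpred_and (dP i) IH) => t; split=> [[Pi Ps] j|Pt].
  by rewrite inE => /predU1P[->//|/Ps].
by split=> [|j js]; apply: Pt; rewrite inE ?eqxx ?js ?orbT.
Qed.

Lemma dpred_comp_term T k (c : T -> 'rV[F]_k) T' k' (c' : T' -> 'rV[F]_k')
    (g : T' -> T) (s : 'I_k -> term M k') P :
  (forall t i, c (g t) ord0 i = eval (c' t) (s i)) ->
  dpred c P -> dpred c' (fun t => P (g t)).
Proof.
move=> gs [f fP]; have [h hP] := holds_subst f s; exists h => t.
rewrite fP hP; suff -> : c (g t) = \row_i eval (c' t) (s i) by [].
by apply/rowP => i; rewrite mxE gs.
Qed.

Lemma dpred_exv n T k (c : T -> 'rV[F]_k) (P : T -> 'rV[F]_n -> Prop) :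
  dpred (extv c) (fun p => P p.1 p.2) -> dpred c (fun t => exists x, P t x).
Proof.
elim: n T k c P => [|n IH] T k c P dP.
  apply: eq_dpred (_ : dpred c (fun t => P t 0)) => [t|].
    by split=> [Pt|[x]]; [exists 0 | rewrite [x]thinmx0].
  apply: (dpred_comp_term (g := fun t => (t, 0)) (s := fun i => Var M i)) dP.
  move=> t i /=; rewrite /extv /= -[RHS](@row_mxEr _ 1 0 k 0 (c t)).
  by congr (row_mx _ _ _ _); exact: ord_inj.
apply: (eq_dpred (P := fun t => exists a, exists x : 'rV_n,
           P t (row_mx (const_mx a : 'rV_1) x : 'rV_(1 + n)))) => [t|].
  split=> [[a [x Px]]|[x Px]]; first by eexists; exact: Px.
  exists (x ord0 ord0), (@rsubmx _ 1 1 n x).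
  rewrite [const_mx _](_ : _ = @lsubmx _ 1 1 n x) ?hsubmxK //.
  by apply/rowP => i; rewrite [i]ord1 !mxE; congr (x _ _); exact: ord_inj.
apply/dpred_ex/IH.
(* A reindexing: the induction hypothesis lists the coordinates as [x], [a], [c t], whereas [dP]
   expects [a], [x], [c t]. *)
pose s (i : 'I_(n.+1 + k)) : term M (n + (1 + k)) :=
  match split i with
  | inl j => match @split 1 n j with
             | inl _ => Var M (rshift n (lshift k ord0))
             | inr j' => Var M (lshift _ j') end
  | inr j => Var M (rshift n (rshift 1 j)) end.
apply: (dpred_comp_term (s := s) (g := fun q : T * F * 'rV_n =>
   (q.1.1, row_mx (const_mx q.1.2 : 'rV_1) q.2 : 'rV_(1 + n)))) dP => -[[t a] x] i.
rewrite /s /extv /ext /= [LHS]mxE; case: (split i) => j /=; last by rewrite !row_mxEr.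
by rewrite [LHS]mxE; case: (@split 1 n j) => j'; rewrite /= ?row_mxEr ?row_mxEl ?mxE.
Qed.

(** Since [g] need not be given by terms, substitution does not apply directly; the coordinates of
    [c (g t)] are introduced as an existentially quantified vector, and the formula for [P] is
    evaluated there. *)
Lemma dpred_comp T k (c : T -> 'rV[F]_k) T' k' (c' : T' -> 'rV[F]_k')
    (g : T' -> T) P :
  (forall i, dfun c' (fun t => c (g t) ord0 i)) ->
  dpred c P -> dpred c' (fun t => P (g t)).
Proof.
move=> dg [f fP].
apply: (eq_dpred (P := fun t => exists x : 'rV_k,
    (forall i, x ord0 i = c (g t) ord0 i) /\ holds f x)) => [t|].
  split=> [[x [/rowP -> ]]|]; rewrite ?fP // => ft.
  by exists (c (g t)).
apply: dpred_exv; apply: dpred_and; last first.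
  have df : dpred (fun x => x) (holds f) by exists f.
  apply: (dpred_comp_term (g := snd) (s := fun i => Var M (lshift k' i))) df.
  by move=> [t x] i; rewrite /= row_mxEl.
apply: dpred_forall_fin => i.
apply: (dpred_comp_term (g := fun p : T' * 'rV_k => (p.1, p.2 ord0 i))
  (s := fun j => match @split 1 k' j with inl _ => Var M (lshift k' i)
                 | inr j' => Var M (rshift k j') end)) (dg i).
move=> [t x] j; rewrite /ext /extv /= [LHS]mxE; case: (@split 1 k' j) => j' /=.
  by rewrite row_mxEl mxE.
by rewrite row_mxEr.
Qed.

(** * Definable functions *)

Lemma dfun_term T k (c : T -> 'rV[F]_k) f (u : term M k) :
  (forall t, f t = eval (c t) u) -> dfun c f.
Proof.
move=> fu; have [v vP] := eval_subst (fun i => Var M (rshift 1 i)) u.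
exists (Eq (Var M (@lshift 1 k ord0)) v) => -[t a]; rewrite /ext /= row_mxEl mxE vP fu.
suff -> : \row_i eval (row_mx (const_mx a : 'rV_1) (c t)) (Var M (rshift 1 i)) = c t by [].
by apply/rowP => i; rewrite mxE /= row_mxEr.
Qed.

Lemma dfun_const T k (c : T -> 'rV[F]_k) a : dfun c (fun=> a).
Proof. exact: (@dfun_term _ _ _ _ (Param M k a)). Qed.

Lemma dfun_coord T k (c : T -> 'rV[F]_k) i : dfun c (fun t => c t ord0 i).
Proof. exact: (@dfun_term _ _ _ _ (Var M i)). Qed.

Lemma dfun_coord1 : dfun coord1 (fun t => t).
Proof.
by apply: (@dfun_term _ _ _ _ (Var M ord0)) => t; rewrite /= mxE.
Qed.

Lemma dfun_ext_snd T k (c : T -> 'rV[F]_k) : dfun (ext c) (fun p => p.2).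
Proof.
apply: (@dfun_term _ _ _ _ (Var M (@lshift 1 k ord0))) => p.
by rewrite /= row_mxEl mxE.
Qed.

Lemma dfun_extv_snd T k n (c : T -> 'rV[F]_k) i :
  dfun (extv c) (fun p : T * 'rV_n => p.2 ord0 i).
Proof.
by apply: (@dfun_term _ _ _ _ (Var M (lshift k i))) => p; rewrite /= row_mxEl.
Qed.

Lemma dpred_ext T k (c : T -> 'rV[F]_k) P :
  dpred c P -> dpred (ext c) (fun p => P p.1).
Proof.
apply: (dpred_comp_term (s := fun i => Var M (rshift 1 i))) => p i.
by rewrite /= row_mxEr.
Qed.

Lemma dfun_comp T k (c : T -> 'rV[F]_k) T' k' (c' : T' -> 'rV[F]_k')
    (g : T' -> T) f :
  (forall i, dfun c' (fun t => c (g t) ord0 i)) ->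
  dfun c f -> dfun c' (fun t => f (g t)).
Proof.
move=> dg df; apply: (dpred_comp (g := fun p => (g p.1, p.2))) df => i.
rewrite /ext; case: (split_ordP (i : 'I_(1 + k))) => j ->.
  under [X in dfun _ X]funext do rewrite row_mxEl mxE.
  exact: dfun_ext_snd.
under [X in dfun _ X]funext do rewrite row_mxEr.
apply: (dpred_comp_term (g := fun q : T' * F * F => (q.1.1, q.2))
  (s := fun l => match @split 1 k' l with
    | inl _ => Var M (@lshift 1 (1 + k') ord0)
    | inr l' => Var M (rshift 1 (rshift 1 l')) end)) (dg j).
move=> [[t a] b] l; rewrite /ext /= [LHS]mxE; case: (@split 1 k' l) => l' /=.
  by rewrite row_mxEl !mxE.
by rewrite !row_mxEr.
Qed.

Lemma dfun_ext T k (c : T -> 'rV[F]_k) f :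
  dfun c f -> dfun (ext c) (fun p => f p.1).
Proof.
apply: dfun_comp => i; apply: (@dfun_term _ _ _ _ (Var M (rshift 1 i))) => p.
by rewrite /= row_mxEr.
Qed.

Lemma dfun_extv T k n (c : T -> 'rV[F]_k) f :
  dfun c f -> dfun (extv c) (fun p : T * 'rV_n => f p.1).
Proof.
apply: dfun_comp => i; apply: (@dfun_term _ _ _ _ (Var M (rshift n i))) => p.
by rewrite /= row_mxEr.
Qed.

Lemma dfun_comp1 T k (c : T -> 'rV[F]_k) (f : F -> F) g :
  dfun coord1 f -> dfun c g -> dfun c (fun t => f (g t)).
Proof.
move=> df dg; apply: dfun_comp df => i.
by under [X in dfun _ X]funext do rewrite mxE.
Qed.

Lemma dpred_comp1 T k (c : T -> 'rV[F]_k) (P : F -> Prop) f :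
  dpred coord1 P -> dfun c f -> dpred c (fun t => P (f t)).
Proof.
move=> dP df; apply: dpred_comp dP => i.
by under [X in dfun _ X]funext do rewrite mxE.
Qed.

Lemma dpred_op2 T k (c : T -> 'rV[F]_k) (P : F -> F -> Prop) f g :
  dpred (ext coord1) (fun p => P p.1 p.2) -> dfun c f -> dfun c g ->
  dpred c (fun t => P (f t) (g t)).
Proof.
move=> dP df dg; apply: (dpred_comp (g := fun t => (f t, g t))) dP => i /=.
case: (split_ordP (i : 'I_(1 + 1))) => j ->.
  by under [X in dfun _ X]funext do rewrite row_mxEl mxE.
by under [X in dfun _ X]funext do rewrite row_mxEr mxE.
Qed.

Lemma dfun_op2 T k (c : T -> 'rV[F]_k) (o : F -> F -> F) f g :
  dfun (ext coord1) (fun p => o p.1 p.2) -> dfun c f -> dfun c g ->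
  dfun c (fun t => o (f t) (g t)).
Proof.
move=> do_ df dg; apply: (dfun_comp (g := fun t => (f t, g t))) do_ => i /=.
case: (split_ordP (i : 'I_(1 + 1))) => j ->.
  by under [X in dfun _ X]funext do rewrite row_mxEl mxE.
by under [X in dfun _ X]funext do rewrite row_mxEr mxE.
Qed.

(** [ext] puts the second component of a pair in slot 0, so the first component is read on the
    right. *)
Let V1 : term M (1 + 1) := Var M (rshift 1 ord0).
Let V2 : term M (1 + 1) := Var M (lshift 1 ord0).

Let V1E (p : F * F) : eval (ext coord1 p) V1 = p.1.
Proof. by rewrite /= row_mxEr mxE. Qed.

Let V2E (p : F * F) : eval (ext coord1 p) V2 = p.2.
Proof. by rewrite /= row_mxEl mxE. Qed.

Lemma dpred_eq T k (c : T -> 'rV[F]_k) f g :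
  dfun c f -> dfun c g -> dpred c (fun t => f t = g t).
Proof.
apply: (dpred_op2 (P := @eq F)); exists (Eq V1 V2) => p.
change (p.1 = p.2 <-> eval (ext coord1 p) V1 = eval (ext coord1 p) V2).
by rewrite V1E V2E.
Qed.

Lemma dpred_lt T k (c : T -> 'rV[F]_k) f g :
  dfun c f -> dfun c g -> dpred c (fun t => f t < g t).
Proof.
apply: (dpred_op2 (P := fun a b => a < b)); exists (Lt V1 V2) => p.
change (p.1 < p.2 <-> eval (ext coord1 p) V1 < eval (ext coord1 p) V2).
by rewrite V1E V2E.
Qed.

Lemma dpred_le T k (c : T -> 'rV[F]_k) f g :
  dfun c f -> dfun c g -> dpred c (fun t => f t <= g t).
Proof.
move=> df dg; apply: eq_dpred (dpred_not (dpred_lt dg df)) => t.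
by rewrite leNgt; split=> /negP.
Qed.

Lemma dfun_add T k (c : T -> 'rV[F]_k) f g :
  dfun c f -> dfun c g -> dfun c (fun t => f t + g t).
Proof.
apply: (dfun_op2 (o := +%R)); apply: (@dfun_term _ _ _ _ (Add V1 V2)) => p.
change (p.1 + p.2 = eval (ext coord1 p) V1 + eval (ext coord1 p) V2).
by rewrite V1E V2E.
Qed.

Lemma dfun_mul T k (c : T -> 'rV[F]_k) f g :
  dfun c f -> dfun c g -> dfun c (fun t => f t * g t).
Proof.
apply: (dfun_op2 (o := *%R)); apply: (@dfun_term _ _ _ _ (Mul V1 V2)) => p.
change (p.1 * p.2 = eval (ext coord1 p) V1 * eval (ext coord1 p) V2).
by rewrite V1E V2E.
Qed.

Lemma dfun_opp T k (c : T -> 'rV[F]_k) f :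
  dfun c f -> dfun c (fun t => - f t).
Proof.
move=> df; under [X in dfun _ X]funext do rewrite -mulN1r.
exact: dfun_mul (dfun_const _ _) df.
Qed.

Lemma dfun_if T k (c : T -> 'rV[F]_k) (b : T -> bool) f g :
  dpred c b -> dfun c f -> dfun c g -> dfun c (fun t => if b t then f t else g t).
Proof.
move=> db df dg; rewrite /dfun.
apply: (eq_dpred (P := fun p => (b p.1 /\ p.2 = f p.1) \/ (~ b p.1 /\ p.2 = g p.1))).
  move=> [t a] /=; case: (b t); split=> //; first by case=> -[].
  - by left.
  - by case=> -[].
  - by right.
by apply: dpred_or; apply: dpred_and => //; [|apply: dpred_not]; exact: dpred_ext db.
Qed.

Lemma dfun_min T k (c : T -> 'rV[F]_k) f g :
  dfun c f -> dfun c g -> dfun c (fun t => Num.min (f t) (g t)).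
Proof. by move=> df dg; apply: dfun_if => //; exact: dpred_lt. Qed.

Lemma dfun_norm T k (c : T -> 'rV[F]_k) f :
  dfun c f -> dfun c (fun t => `|f t|).
Proof.
move=> df; under [X in dfun _ X]funext => t.
  rewrite (_ : `|f t| = if 0 <= f t then f t else - f t); last first.
    by case: ifPn => [/ger0_norm|]; rewrite -?ltNge // => /ltr0_norm.
  over.
apply: dfun_if => //; last exact: dfun_opp.
by apply: dpred_le => //; exact: dfun_const.
Qed.

Lemma dfun_sum T k (c : T -> 'rV[F]_k) n (f : T -> 'I_n -> F) :
  (forall i, dfun c (f^~ i)) -> dfun c (fun t => \sum_(i < n) f t i).
Proof.
move=> df; elim: n f df => [|n IH] f df.
  under [X in dfun _ X]funext do rewrite big_ord0.
  exact: dfun_const.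
under [X in dfun _ X]funext do rewrite big_ord_recr /=.
by apply: dfun_add => //; exact: IH.
Qed.

(* For a variable bound further out, [f] is a projection chain such as
   [fun p => p.1.1.2], which does not unify with [fun p => f p.1]; the side
   condition, closed by reflexivity, detects that [f] ignores [p.2]. *)
Lemma dfun_ext_weaken T k (c : T -> 'rV[F]_k) (f : T * F -> F) :
  (forall t a b, f (t, a) = f (t, b)) ->
  dfun c (fun t => f (t, 0)) -> dfun (ext c) f.
Proof.
move=> fC /dfun_ext; congr (dfun _ _); apply/funext => -[t a]; exact: fC.
Qed.

Lemma dfun_extv_weaken T k n (c : T -> 'rV[F]_k) (f : T * 'rV_n -> F) :
  (forall t a b, f (t, a) = f (t, b)) ->
  dfun c (fun t => f (t, 0)) -> dfun (extv c) f.
Proof.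
move=> fC /dfun_extv; move=> /(_ n); congr (dfun _ _); apply/funext => -[t a]; exact: fC.
Qed.

Lemma dpred_set n (E : classical_sets.set 'rV[F]_n) T k (c : T -> 'rV[F]_k)
    (g : T -> 'rV[F]_n) :
  definable M E -> (forall i, dfun c (fun t => g t ord0 i)) ->
  dpred c (fun t => E (g t)).
Proof. by move=> [f ->] dg; apply: (dpred_comp (c := id)) => //; exists f. Qed.

Lemma dpred_comp_ext T k (c : T -> 'rV[F]_k) (P : T -> F -> Prop) T' k'
    (c' : T' -> 'rV[F]_k') (g : T' -> T) f :
  dpred (ext c) (fun p => P p.1 p.2) ->
  (forall i, dfun c' (fun t => c (g t) ord0 i)) -> dfun c' f ->
  dpred c' (fun t => P (g t) (f t)).
Proof.
move=> dP dg df; apply: (dpred_comp (g := fun t => (g t, f t))) dP => i /=.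
case: (split_ordP (i : 'I_(1 + k))) => j ->.
  by under [X in dfun _ X]funext do rewrite row_mxEl mxE.
by under [X in dfun _ X]funext do rewrite row_mxEr.
Qed.

Lemma dpred_definable1 (X : F -> Prop) : dpred coord1 X -> definable1 M X.
Proof.
move=> [f fP]; exists f; apply/funext => x; apply/propext; rewrite /= fP /coord1.
suff -> : const_mx (x ord0 ord0) = x by [].
by apply/rowP => i; rewrite [i]ord1 mxE.
Qed.

(** The coordinates of [c t] become parameters of the formula. *)
Lemma dpred_fiber T k (c : T -> 'rV[F]_k) (P : T -> F -> Prop) t :
  dpred (ext c) (fun p => P p.1 p.2) -> dpred coord1 (P t).
Proof.
apply: (dpred_comp_term (g := fun a => (t, a)) (s := fun j =>
  match @split 1 k j with inl _ => Var M ord0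
  | inr j' => Param M _ (c t ord0 j') end)) => a j.
rewrite /ext /= [LHS]mxE; case: (@split 1 k j) => j' /=; by rewrite ?mxE.
Qed.

End DefinabilityCalculus.

(** * Automation of definability goals *)

Ltac dfun_step :=
  first
  [ assumption
  | exact: dfun_const
  | exact: dfun_coord1
  | exact: dfun_ext_snd
  | exact: dfun_extv_snd
  | exact: dfun_coord
  | lazymatch goal with
    | |- dfun _ _ (fun t => _ + _)%R => apply: dfun_add
    | |- dfun _ _ (fun t => _ * _)%R => apply: dfun_mul
    | |- dfun _ _ (GRing.mul ?a) => apply: (dfun_mul (f := fun=> a) (g := id))
    | |- dfun _ _ (fun t => - _)%R => apply: dfun_opp
    | |- dfun _ _ (fun t => Num.min _ _) => apply: dfun_min
    | |- dfun _ _ (fun t => `|_|)%R => apply: dfun_norm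
    | |- dfun _ _ (fun t => \sum_(i < _) _)%R => apply: dfun_sum => ?
    | H : dfun _ (@coord1 _) ?f |- dfun _ _ (fun t => ?f _) =>
        apply: (dfun_comp1 H)
    end
  | apply: dfun_ext_weaken; [reflexivity | ]
  | apply: dfun_extv_weaken; [reflexivity | ] ].

Ltac dpred_step :=
  first
  [ assumption
  | lazymatch goal with
    | |- dpred _ _ (fun t => ~ _) => apply: dpred_not
    | |- dpred _ _ (fun t => _ /\ _) => apply: dpred_and
    | |- dpred _ _ (fun t => _ \/ _) => apply: dpred_or
    | |- dpred _ _ (fun t => @?P t -> @?Q t) => apply: dpred_imp
    | |- dpred _ _ (fun t => forall a : 'I__, _) => apply: dpred_forall_fin => ?
    | |- dpred _ _ (fun t => forall a, _) => apply: dpred_all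
    | |- dpred _ _ (fun t => exists a : 'rV__, _) => apply: dpred_exv
    | |- dpred _ _ (fun t => exists a, _) => apply: dpred_ex
    | |- dpred _ _ (fun t => _ = _) => apply: dpred_eq
    | |- dpred _ _ (fun t => is_true (_ < _)%R) => apply: dpred_lt
    | |- dpred _ _ (fun t => is_true (_ <= _)%R) => apply: dpred_le
    | H : definable _ ?E |- dpred _ _ (fun t => ?E _) =>
        apply: (dpred_set H) => ?
    | H : dpred _ (@coord1 _) ?P |- dpred _ _ (fun t => ?P _) =>
        apply: (dpred_comp1 H)
    | H : dpred _ (ext (@coord1 _)) (fun p => ?P p.1 p.2) |- dpred _ _ (fun t => ?P _ _) =>
        apply: (dpred_op2 H)
    | H : dpred _ (ext _) (fun p => ?P p.1 p.2) |- dpred _ _ (fun t => ?P _ _) =>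
        apply: (dpred_comp_ext H); [move=> ? | ]
    end ].

Ltac dfn :=
  repeat (cbn [fst snd];
    lazymatch goal with
    | |- dfun _ _ _ => dfun_step
    | |- dpred _ _ _ => dpred_step
    end).

(** * One-sided germs, infima and definable choice *)

Section RightGerms.
Local Open Scope ring_scope.
Local Open Scope classical_set_scope.
Variable F : realFieldType.

Definition near_right (a : F) (P : F -> Prop) :=
  exists2 d, 0 < d & forall x, a < x -> x < a + d -> P x.

Lemma near_right_and a P Q :
  near_right a P -> near_right a Q -> near_right a (fun x => P x /\ Q x).
Proof.
move=> [d d0 dP] [e e0 eQ]; exists (Num.min d e); first by rewrite lt_min d0.
by move=> x ax xde; split; [apply: dP|apply: eQ] => //;
  apply: lt_le_trans xde _; rewrite lerD2l ge_min lexx ?orbT.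
Qed.

Lemma near_right_imp a (P Q : F -> Prop) :
  (forall x, a < x -> P x -> Q x) -> near_right a P -> near_right a Q.
Proof. by move=> PQ [d d0 dP]; exists d => // x ax xd; apply: PQ => //; apply: dP. Qed.

Lemma near_right_lt a b : a < b -> near_right a (fun x => x < b).
Proof. by move=> ab; exists (b - a); [rewrite subr_gt0|move=> x _; rewrite addrC subrK]. Qed.

Lemma near_right_ex a P : near_right a P -> exists2 x, a < x & P x.
Proof. by move=> [d d0 dP]; exists (a + d / 2); [|apply: dP]; lra. Qed.

(** The form in which local o-minimality is used: an excluded middle for right germs. *)
Definition right_decided (a : F) (P : F -> Prop) :=
  near_right a P \/ near_right a (fun x => ~ P x).

Lemma eq_right_decided (a : F) (P Q : F -> Prop) :
  (forall x, P x <-> Q x) -> right_decided a P -> right_decided a Q.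
Proof.
move=> PQ [aP|aP]; [left|right]; apply: near_right_imp aP => x _.
  exact: (PQ x).1.
by move=> nP /PQ.
Qed.

Lemma right_decided_or a (P Q : F -> Prop) :
  right_decided a P -> right_decided a Q -> right_decided a (fun x => P x \/ Q x).
Proof.
move=> [aP|aP]; first by left; apply: near_right_imp aP => *; left.
move=> [aQ|aQ]; first by left; apply: near_right_imp aQ => *; right.
by right; apply: near_right_imp (near_right_and aP aQ) => x _ [? ?] [].
Qed.

Lemma right_decided_open_interval (a : F) (l r : \bar F) :
  right_decided a (open_interval l r).
Proof.
have [la|] := boolP (l <= a%:E)%E; last first.
  rewrite -ltNge => al; right; case: l al => [l| |]//.
    rewrite lte_fin => /near_right_lt; apply: near_right_imp => x _ xl [] /=.
    by rewrite lte_fin ltNge ltW.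
  by move=> _; exists 1 => // x _ _ [].
have [ar|] := boolP (a%:E < r)%E; last first.
  rewrite -leNgt => ra; right; exists 1 => // x ax _ [_] /=.
  by rewrite ltNge (le_trans ra) // lee_fin ltW.
left; case: r ar => [r| |]//.
  rewrite lte_fin => /near_right_lt; apply: near_right_imp => x ax xr.
  by split; rewrite /= ?lte_fin // (le_lt_trans la) // lte_fin.
by exists 1 => // x ax _; split; rewrite /= ?ltry // (le_lt_trans la) // lte_fin.
Qed.

Lemma right_decided_finite_union (a : F) (X : set F) :
  finite_union_points_intervals X -> right_decided a X.
Proof.
move=> [ps [js ->]].
apply: (eq_right_decided
  (P := fun x => x \in ps \/ exists2 j, j \in js & open_interval j.1 j.2 x)) => [//|].
apply: right_decided_or.
    right; elim: ps => [|p ps IH]; first by exists 1.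
    have {}IH := near_right_and IH _.
    apply: (near_right_imp (P := fun x => ~ x \in ps /\ x != p)) => [x _ [xps /negP xp]|].
      by rewrite inE => /orP[].
    apply: IH; have [ap|pa] := ltP a p.
      by apply: near_right_imp (near_right_lt ap) => x _ /lt_eqF ->.
    by exists 1 => // x ax _; rewrite gt_eqF // (le_lt_trans pa).
  elim: js => [|j js IH]; first by right; exists 1 => // x _ _ [].
  apply: eq_right_decided (right_decided_or (right_decided_open_interval a j.1 j.2) IH).
  move=> x; split.
    by move=> [?|[i ijs ?]]; [exists j|exists i]; rewrite // inE ?eqxx // ijs orbT.
  by move=> [i]; rewrite inE => /predU1P[->|]; [left|right; exists i].
Qed.

End RightGerms.

(** * Definable infima, square roots and choice *)

Section DefinablyCompleteLocallyOminimal.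
Local Open Scope ring_scope.
Local Open Scope classical_set_scope.
Variables (F : realFieldType) (M : expansion F).
Hypothesis (HC : definably_complete M).

Definition is_glb (X : F -> Prop) m :=
  (forall x, X x -> m <= x) /\ (forall b, (forall x, X x -> b <= x) -> b <= m).

Lemma is_glb_inj X m m' : is_glb X m -> is_glb X m' -> m = m'.
Proof. by move=> [? mX] [? m'X]; apply/le_anti; rewrite m'X // mX. Qed.

Lemma is_glb_lt X m y : is_glb X m -> m < y -> exists2 x, X x & x < y.
Proof.
move=> [_ mX] my; apply: contrapT => Xy; suff: y <= m by rewrite leNgt my.
apply: mX => x Xx; rewrite leNgt; apply/negP => xy; apply: Xy; by exists x.
Qed.

Lemma glb_exists (X : F -> Prop) : dpred M (@coord1 F) X ->
  (exists x, X x) -> (exists b, forall x, X x -> b <= x) -> exists m, is_glb X m.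
Proof.
move=> /dpred_definable1/HC[_ [i [ilb iglb]]] [x0 Xx0] [b bX].
have ix0 : (i <= x0%:E)%E by apply: ilb; exists x0.
have bi : (b%:E <= i)%E.
  by apply: iglb => _ [x Xx <-]; rewrite lee_fin bX.
case: i ilb iglb ix0 bi => [m| |] ilb iglb // _ _.
exists m; split=> [x Xx|b' b'X]; first by rewrite -lee_fin; apply: ilb; exists x.
by rewrite -lee_fin; apply: iglb => _ [x Xx <-]; rewrite lee_fin b'X.
Qed.

(** Infima taken uniformly in [t]. The graph is definable because an infimum is unique and the
    default 0 occurs exactly when there is none. *)
Lemma dfun_glb T k (c : T -> 'rV[F]_k) (P : T -> F -> Prop) :
  dpred M (ext c) (fun p => P p.1 p.2) ->
  exists2 m : T -> F, dfun M c m &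
    forall t, (exists x, P t x) -> (exists b, forall x, P t x -> b <= x) ->
      is_glb (P t) (m t).
Proof.
move=> dP; exists (fun t => xget 0 (is_glb (P t))); last first.
  move=> t Px Pb; have [m mP] := glb_exists (dpred_fiber t dP) Px Pb.
  exact: (xgetPex 0 (ex_intro _ m mP)).
apply: (eq_dpred (P := fun p => is_glb (P p.1) p.2 \/
    ~ (exists a, is_glb (P p.1) a) /\ p.2 = 0)) => [[t a]/=|].
  split=> [[aP|[Pn ->]]|->].
  - by apply: (is_glb_inj aP); exact: (xgetPex 0 (ex_intro _ a aP)).
  - by rewrite xgetPN // => x Px; apply: Pn; exists x.
  - have [[m mP]|Pn] := pselect (exists a, is_glb (P t) a).
      by left; exact: (xgetPex 0 (ex_intro _ m mP)).
    by right; rewrite xgetPN // => x Px; apply: Pn; exists x.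
rewrite /is_glb; dfn.
Qed.

(** The root is the infimum [m] of the nonnegative [r] with [a <= r * r]; a strict inequality
    between [m * m] and [a], in either direction, would allow [m] to be moved. *)
Lemma sqrt_exists (a : F) : 0 <= a -> exists2 r, 0 <= r & r ^+ 2 = a.
Proof.
move=> a0.
have [|||m [mlb mglb]] := @glb_exists (fun r => 0 <= r /\ a <= r * r).
- dfn.
- by exists (a + 1); nra.
- by exists 0 => r [].
have m0 : 0 <= m by apply: mglb => r [].
exists m => //; rewrite expr2; apply/eqP; rewrite eq_le !leNgt.
apply/andP; split; apply/negP => ma.
  have m_gt0 : 0 < m by rewrite lt_neqAle m0 andbT; apply/eqP => m0E; nra.
  (* A Newton step: [(m - e) ^+ 2 = a + e ^+ 2], so [m - e] still belongs to the set. *)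
  pose e := (m * m - a) / (2 * m).
  have eE : e * (2 * m) = m * m - a by rewrite /e divfK // mulf_neq0 // gt_eqF.
  have e0 : 0 < e by rewrite divr_gt0 //; lra.
  suff : m <= m - e by lra.
  by apply: mlb; split; nra.
(* As [e <= 1], [(m + e) ^+ 2 <= m * m + e * (2 * m + 1) <= a], so [m + e] is a lower bound of the
   set. *)
pose e := Num.min 1 ((a - m * m) / (2 * m + 1)).
have [e0 e1 ea] : [/\ 0 < e, e <= 1 & e * (2 * m + 1) <= a - m * m].
  split; rewrite /e ?lt_min ?ge_min ?lexx ?ltr01 //=.
    by rewrite divr_gt0; lra.
  by rewrite -ler_pdivlMr ?ge_min ?lexx ?orbT //; lra.
suff : m + e <= m by lra.
apply: mglb => x [x0 ax]; rewrite leNgt; apply/negP => xm; nra.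
Qed.

Hypothesis (HO : locally_ominimal M).

(** Local o-minimality decides [X] only inside an interval around [a], but that interval contains a
    right neighbourhood of [a]. *)
Lemma definable_right_decided (X : F -> Prop) a :
  dpred M (@coord1 F) X -> right_decided a X.
Proof.
move=> /dpred_definable1/(HO a)[l [r [alr /(right_decided_finite_union a) XI]]].
have aI : near_right a (open_interval l r).
  case: alr => la ar.
  have [//|[d d0 dP]] := right_decided_open_interval a l r.
  case: r ar dP {XI} => [r| |] // ar dP.
    have /near_right_ex[x ax [/= xd xr]] :
      near_right a (fun x => x < a + d /\ x < r).
      by apply: near_right_and; apply: near_right_lt; [lra|rewrite -lte_fin].
    by case: (dP x) => //; split; rewrite /= ?lte_fin // (lt_trans la) // lte_fin.
  by case: (dP (a + d / 2)); [lra|lra|]; split; rewrite /= ?ltry // (lt_trans la) // lte_fin; lra.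
case: XI => XI; [left|right].
  by apply: near_right_imp XI => x _ [].
by apply: near_right_imp (near_right_and XI aI) => x _ [] /[swap] ? /[swap] ? [].
Qed.

(* If the infimum [m] of the fiber is not attained, [(m, w)] is the largest
   interval of length at most 1 contained in the fiber, and its midpoint is
   chosen. *)
Lemma definable_choice1 T k (c : T -> 'rV[F]_k) (P : T -> F -> Prop) :
  dpred M (ext c) (fun p => P p.1 p.2) ->
  exists2 f : T -> F, dfun M c f &
    forall t, (exists x, P t x) -> (exists b, forall x, P t x -> b <= x) ->
      P t (f t).
Proof.
move=> dP; have [m dm mP] := dfun_glb dP.
have [|w dw wP] := @dfun_glb _ _ c (fun t z => m t < z /\ (~ P t z \/ z = m t + 1)).
  dfn.
exists (fun t => if `[< P t (m t) >] then m t else (m t + w t) * 2^-1).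
  apply: dfun_if; [|by []|by dfn].
  by apply: (eq_dpred (P := fun t => P t (m t))) => [t|]; [rewrite asboolE|dfn].
move=> t Pt Pb; case: asboolP => // Pm.
have [mlb mglb] := mP t Pt Pb.
have Pgt x : P t x -> m t < x.
  by move=> Px; rewrite lt_neqAle mlb // andbT; apply/eqP => mx; rewrite mx in Pm.
have [||wlb wglb] := wP t.
- by exists (m t + 1); split; [lra|right].
- by exists (m t) => x [/ltW].
have [[d d0 dPt]|[d d0 dPt]] := definable_right_decided (m t) (dpred_fiber t dP); last first.
  suff : m t + d <= m t by lra.
  by apply: mglb => x Px; rewrite leNgt; apply/negP => /dPt; apply => //; exact: Pgt.
have mw : m t < w t.
  suff : Num.min (m t + d) (m t + 1) <= w t.
    by apply: lt_le_trans; rewrite lt_min; apply/andP; split; lra.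
  apply: wglb => z [mz [Pz|->]]; rewrite ge_min ?lexx ?orbT //.
  by apply/orP; left; rewrite leNgt; apply/negP => /(dPt _ mz).
apply: contrapT => nP.
suff : w t <= (m t + w t) * 2^-1 by lra.
by apply: wlb; split; [lra|left].
Qed.

(** Induction on the dimension: [definable_choice1] picks a first coordinate among those that extend
    to a point of the fiber, and the induction hypothesis picks the others over it. *)
Lemma definable_choice n T k (c : T -> 'rV[F]_k) (P : T -> 'rV[F]_n -> Prop) :
  dpred M (extv c) (fun p => P p.1 p.2) ->
  exists2 f : T -> 'rV[F]_n, (forall i, dfun M c (fun t => f t ord0 i)) &
    forall t, (exists x, P t x) ->
      (exists b, forall x i, P t x -> b <= x ord0 i) -> P t (f t).
Proof.
elim: n P => [|n IH] P dP.
  exists (fun=> 0) => [[]//|t [x Px] _].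
  by rewrite (_ : 0 = x) //; apply/rowP => -[].
pose cons (a : F) (x : 'rV[F]_n) : 'rV[F]_n.+1 := row_mx (const_mx a : 'rV_1) x.
have cons0 a x : cons a x ord0 ord0 = a.
  rewrite /cons (_ : ord0 = @lshift 1 n ord0); last exact: ord_inj.
  by rewrite (@row_mxEl _ 1 1 n) mxE.
have consS a x i : cons a x ord0 (rshift 1 i) = x ord0 i.
  by rewrite /cons (@row_mxEr _ 1 1 n).
have consK x : exists a y, x = cons a y.
  exists (x ord0 ord0), (@rsubmx _ 1 1 n x); rewrite /cons.
  rewrite [const_mx _](_ : _ = @lsubmx _ 1 1 n x) ?hsubmxK //.
  by apply/rowP => i; rewrite [i]ord1 !mxE; congr (x _ _); exact: ord_inj.
have dcons T' k' (c' : T' -> 'rV[F]_k') (g : T' -> T) a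
      (x : T' -> 'rV[F]_n) :
    (forall i, dfun M c' (fun t => c (g t) ord0 i)) -> dfun M c' a ->
    (forall i, dfun M c' (fun t => x t ord0 i)) ->
    dpred M c' (fun t => P (g t) (cons (a t) (x t))).
  move=> dg da dx.
  apply: (dpred_comp (g := fun t => (g t, cons (a t) (x t)))) dP => i.
  case: (split_ordP i) => j ->.
    under [X in dfun _ _ X]funext do rewrite row_mxEl /=.
    case: (@split_ordP 1 n j) => l ->.
      rewrite [l]ord1 (_ : lshift n ord0 = ord0); last exact: ord_inj.
      by under [X in dfun _ _ X]funext do rewrite cons0.
    by under [X in dfun _ _ X]funext do rewrite consS.
  by under [X in dfun _ _ X]funext do rewrite row_mxEr.
have [|f df fP] := @definable_choice1 _ _ c (fun t a => exists x, P t (cons a x)).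
  by apply: dpred_exv; apply: (dcons _ _ _ (fun q => q.1.1)) => [i| |i]; dfn.
have [|h dh hP] := IH (fun t x => P t (cons (f t) x)).
  by apply: (dcons _ _ _ (fun q => q.1)) => [i| |i]; dfn.
exists (fun t => cons (f t) (h t)) => [i|t [x0 Px0] [b bP]].
  case: (@split_ordP 1 n i) => l ->.
    rewrite [l]ord1 (_ : lshift n ord0 = ord0); last exact: ord_inj.
    by under [X in dfun _ _ X]funext do rewrite cons0.
  by under [X in dfun _ _ X]funext do rewrite consS.
apply: hP.
  apply: fP; first by have [a [x xE]] := consK x0; exists a, x; rewrite -xE.
  by exists b => a [x /bP]/(_ ord0); rewrite cons0.
by exists b => x i /bP; rewrite -(consS (f t)).
Qed.

End DefinablyCompleteLocallyOminimal.

(** * Definable functions of one variable *)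

Section OneVariable.
Local Open Scope ring_scope.
Variables (F : realFieldType) (M : expansion F).
Hypotheses (HC : definably_complete M) (HO : locally_ominimal M).

Local Notation dfun1 := (dfun M (@coord1 F)).

(* Call [p] a record if some [S p e] holds while [S q e] fails for all [q]
   between [x0] and [p]. Near [x0] either no point is a record, and a least
   point where [S _ e] holds is one; or every point is, and [S] cannot die out
   to the right of any of them. *)
Lemma vanishing_family_False (S : F -> F -> Prop) (x0 b : F) :
  dpred M (ext (@coord1 F)) (fun p => S p.1 p.2) -> x0 < b ->
  (forall p e e', S p e -> e' <= e -> S p e') ->
  (forall p, x0 < p -> p < b -> exists2 e, 0 < e & S p e) ->
  (forall p e, x0 <= p -> p < b -> 0 < e -> near_right p (fun q => ~ S q e)) ->
  False.
Proof.
move=> dS x0b Smono Spos Svan.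
have [|[d d0 dR]|[d d0 dR]] := @definable_right_decided _ _ HO (fun p => exists e,
    0 < e /\ S p e /\ forall q, x0 < q -> q < p -> ~ S q e) x0; first by dfn.
- have x0d : x0 < x0 + d by lra.
  have /near_right_ex[p x0p [pb pd]] :=
    near_right_and (near_right_lt x0b) (near_right_lt x0d).
  have [e e0 Spe] := Spos p x0p pb.
  have /near_right_ex[q pq [nSqe qd]] :=
    near_right_and (Svan p e (ltW x0p) pb e0) (near_right_lt pd).
  have [e' [e'0 [Sqe' /(_ p x0p pq) nSpe']]] := dR q (lt_trans x0p pq) qd.
  have [e'e|/ltW ee'] := leP e' e; first exact: nSpe' (Smono _ _ _ Spe e'e).
  exact: nSqe (Smono _ _ _ Sqe' ee').
- have x0d : x0 < x0 + d by lra.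
  have /near_right_ex[p x0p [pb pd]] :=
    near_right_and (near_right_lt x0b) (near_right_lt x0d).
  have [e e0 Spe] := Spos p x0p pb.
  (* This infimum is attained, since [S _ e] dies out to the right of [q0]; hence [q0] is a record.
     As [q0] may be [x0], the vanishing is used at [x0] too. *)
  have [|||q0 q0P] := @glb_exists _ _ HC (fun q => x0 < q /\ q <= p /\ S q e).
  + by dfn.
  + by exists p.
  + by exists x0 => q [/ltW].
  have x0q0 : x0 <= q0 by apply: q0P.2 => q [/ltW].
  have q0p : q0 <= p by apply: q0P.1.
  have [d' d'0 d'S] := Svan q0 e x0q0 (le_lt_trans q0p pb) e0.
  have [[x0q0' [_ Sq0e]]|nq0] := pselect (x0 < q0 /\ q0 <= p /\ S q0 e).
    apply: (dR q0) => //; first exact: le_lt_trans q0p pd.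
    exists e; split=> //; split=> // q x0q qq0 Sqe.
    have : q0 <= q by apply: q0P.1; split=> //; split=> //; lra.
    by rewrite leNgt qq0.
  have [|x xX xd] := is_glb_lt q0P (_ : q0 < q0 + d'); first by lra.
  apply: (d'S x) => //; last by case: xX => _ [].
  rewrite lt_neqAle q0P.1 // andbT; apply/eqP => q0x.
  by apply: nq0; rewrite q0x.
Qed.

(** [y] is the infimum of the eventual upper bounds of [g] to the right of [p]. By minimality
    [g s <= y - e] cannot hold on a right germ, so its negation does. *)
Lemma right_limit_approx (g : F -> F) p lo hi e : dfun1 g ->
  near_right p (fun s => lo <= g s /\ g s <= hi) -> 0 < e ->
  exists y, near_right p (fun s => y - e < g s /\ g s < y + e).
Proof.
move=> dg gb e0.
pose Y y := exists d, 0 < d /\ forall s, p < s -> s < p + d -> g s <= y.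
have dY : dpred M (@coord1 F) Y by rewrite /Y; dfn.
have [|||y yP] := @glb_exists _ _ HC Y => //.
- by exists hi; case: gb => d d0 dP; exists d; split=> // s ps /(dP _ ps)[].
- exists lo => y [d [d0 dP]].
  have [|s ps [[los _] sd]] := near_right_ex (near_right_and gb (near_right_lt (_ : p < p + d))).
    by lra.
  exact: le_trans los (dP _ ps sd).
have [|[d d0 dP]|gy] := @definable_right_decided _ _ HO (fun s => g s <= y - e) p.
- by dfn.
- suff : y <= y - e by lra.
  by apply: yP.1; exists d.
have [|y' [d [d0 dP]] y'y] := is_glb_lt yP (_ : y < y + e); first by lra.
exists y; have pd : p < p + d by lra.
apply: near_right_imp (near_right_and gy (near_right_lt pd)) => s ps [/negP sy sd].
by rewrite ltNge; split=> //; apply: le_lt_trans (dP _ ps sd) y'y.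
Qed.

Definition lsc_at (g : F -> F) (t : F) := forall e, 0 < e ->
  exists d, 0 < d /\ forall s, t - d < s -> s < t + d -> g t < g s + e.

Lemma near_right_lsc (g : F -> F) a lo hi : dfun1 g ->
  near_right a (fun s => lo <= g s /\ g s <= hi) -> near_right a (lsc_at g).
Proof.
move=> dg gb.
have [|//|gn] := @definable_right_decided _ _ HO (lsc_at g) a.
  by rewrite /lsc_at; dfn.
have [d d0 dP] := near_right_and gb gn; exfalso.
(* Here [S p e] says that [g] takes values at most [g p - e] arbitrarily close to [p]. Failure of
   lower semicontinuity gives it for some [e]; approximate right limits make it die out. *)
apply: (@vanishing_family_False (fun p e => forall d, 0 < d ->
    exists s, p - d < s /\ s < p + d /\ g s + e <= g p) (a + d / 2) (a + d)).
- by dfn.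
- by lra.
- move=> p e e' Spe e'e r /Spe[s [sp [ps gs]]]; exists s; split=> //; split=> //; lra.
- move=> p ap pd; have [|//|_ np] := dP p; first by lra.
  apply: contrapT => nS; apply: np => e e0; apply: contrapT => nd.
  apply: nS; exists e => // r r0; apply: contrapT => ns; apply: nd.
  exists r; split=> // s rs sr; rewrite ltNge; apply/negP => gs.
  by apply: ns; exists s.
- move=> p e ap pd e0.
  have [||y [r r0 rP]] := @right_limit_approx g p lo hi (e / 2) dg; last 1 first.
  + exists r => // q pq qr Sqe.
    (* This radius keeps [s] in the interval from [p] to [p + r], where any two values of [g] differ
       by less than [e]. *)
    have [|s [sq [qs gs]]] := Sqe (Num.min (q - p) (p + r - q)).
      by rewrite lt_min; apply/andP; split; lra.
    have [||? ?] := rP q => //.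
    have [||? ?] := rP s; [| |lra].
      by apply: le_lt_trans sq; rewrite lerBrDr -lerBrDl ge_min lexx.
    by apply: lt_le_trans qs _; rewrite -lerBrDl ge_min lexx orbT.
  + exists (a + d - p); first by lra.
    by move=> s ps sd; have [||//] := dP s; lra.
  + by lra.
Qed.

(** Definable completeness replaces compactness. Without a minimum, let [q] be the infimum of the
    points where [B] fails. Some [z1] has [g z1 < g q], hence lies below [g] near [q] by lower
    semicontinuity; the better of [z1] and a witness for [B] just before [q] proves [B] slightly
    beyond [q]. *)
Lemma lsc_min_attained (g : F -> F) c d : dfun1 g -> c <= d ->
  (forall t, c <= t -> t <= d -> lsc_at g t) ->
  exists p, [/\ c <= p, p <= d & forall s, c <= s -> s <= d -> g p <= g s].
Proof.
move=> dg cd glsc; apply: contrapT => nmin.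
have {nmin}below p : c <= p -> p <= d -> exists z, [/\ c <= z, z <= d & g z < g p].
  move=> cp pd; apply: contrapT => nz; apply: nmin; exists p; split=> // s cs sd.
  by rewrite leNgt; apply/negP => sp; apply: nz; exists s.
pose B x := exists z, c <= z /\ z <= d /\ forall y, c <= y -> y <= x -> g z < g y.
have dB : dpred M (@coord1 F) B by rewrite /B; dfn.
have [|||q qP] := @glb_exists _ _ HC (fun x => c <= x /\ x <= d /\ ~ B x).
- by dfn.
- by exists d; do 2!split=> //; move=> [z [cz [zd /(_ z cz zd)]]]; rewrite ltxx.
- by exists c => x [].
have cq : c <= q by apply: qP.2 => x [].
have qd : q <= d.
  by apply: qP.1; do 2!split=> //; move=> [z [cz [zd /(_ z cz zd)]]]; rewrite ltxx.
have [z1 [cz1 z1d z1q]] := below q cq qd.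
have [|r [r0 rP]] := glsc q cq qd (g q - g z1); first by rewrite subr_gt0.
have {}rP s : q - r < s -> s < q + r -> g z1 < g s.
  by move=> qs sq; have := rP s qs sq; lra.
have [|x [cx [xd nBx]] xr] := is_glb_lt qP (_ : q < q + r); first by lra.
apply: nBx; have [cqr|qrc] := ltP c (q - r / 2); last first.
  by exists z1; do 2!split=> //; move=> y cy yx; apply: rP; lra.
have [z2 [cz2 [z2d z2P]]] : B (q - r / 2).
  apply: contrapT => nB; suff : q <= q - r / 2 by lra.
  by apply: qP.1; split; [lra|split=> //; lra].
have [z12|/ltW z21] := leP (g z1) (g z2).
  exists z1; do 2!split=> //; move=> y cy yx; have [yr|ry] := leP y (q - r / 2).
    exact: le_lt_trans z12 (z2P _ cy yr).
  by apply: rP; lra.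
exists z2; do 2!split=> //; move=> y cy yx; have [yr|ry] := leP y (q - r / 2).
  exact: z2P.
by apply: le_lt_trans z21 _; apply: rP; lra.
Qed.

Lemma near_right_nondecreasing (g : F -> F) : dfun1 g ->
  near_right 0 (fun t => t <= g t /\ g t <= 3 * t) ->
  exists2 d, 0 < d & forall s t, 0 < s -> s <= t -> t < d -> g s <= g t.
Proof.
move=> dg [b b0 gb]; rewrite add0r in gb.
have glsc : near_right 0 (lsc_at g).
  apply: (near_right_lsc (lo := 0) (hi := 3 * b)) => //.
  exists b => // t t0; rewrite add0r => tb; have [? ?] := gb t t0 tb; lra.
have [|[d d0 dA]|nA] := @definable_right_decided _ _ HO (fun t => forall s,
    t <= s -> s < b -> g t <= g s) 0; first by dfn.
  exists (Num.min d b) => [|s t s0 st]; first by rewrite lt_min d0.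
  by rewrite lt_min => /andP[td tb]; apply: dA => //; lra.
have [d d0 dP] := near_right_and (near_right_and nA glsc) (near_right_lt b0).
exfalso; rewrite add0r in dP.
(* The endpoints have ratio 3: for [s > d / 2], [g s >= s > 3 * (d / 6) >= g (d / 6) >= g p]. Thus
   [p] is minimal beyond [d / 2] as well, against [nA]. *)
have [|t t1 t2|p [p1 p2 pmin]] := @lsc_min_attained g (d / 6) (d / 2) dg.
- by lra.
- by have [||[_ ?] _] := dP t; [lra|lra|].
have [||[nAp _] pb] := dP p; [lra|lra|]; apply: nAp => s ps sb.
have [sd|ds] := leP s (d / 2); first by apply: pmin => //; lra.
have : g p <= g (d / 6) by apply: pmin; lra.
have [||_ db] := dP (d / 6); [lra|lra|].
have [||? ?] := gb (d / 6); [lra|lra|].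
have [||? ?] := gb s; [lra|lra|]; lra.
Qed.

Lemma near_right_lipschitz (f : F -> F) : dfun1 f ->
  near_right 0 (fun t => `|f t| <= t) ->
  exists2 d, 0 < d & forall s t, 0 < s -> s < d -> 0 < t -> t < d ->
    `|f s - f t| <= 2 * `|s - t|.
Proof.
move=> df fb.
have [||d d0 dP] := @near_right_nondecreasing (fun t => 2 * t + f t).
- by dfn.
- by apply: near_right_imp fb => t _; rewrite ler_norml => /andP[? ?]; split; lra.
have [||e e0 eP] := @near_right_nondecreasing (fun t => 2 * t - f t).
- by dfn.
- by apply: near_right_imp fb => t _; rewrite ler_norml => /andP[? ?]; split; lra.
exists (Num.min d e) => [|s t s0 + t0]; first by rewrite lt_min d0.
rewrite !lt_min => /andP[sd se] /andP[td te].
wlog st : s t s0 sd se t0 td te / s <= t => [hw|].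
  by have [|/ltW] := leP s t => [|ts]; [|rewrite distrC [`|s - t|]distrC]; apply: hw.
have ? := dP s t s0 st td; have ? := eP s t s0 st te.
rewrite [`|s - t|]distrC [`|t - s|]ger0_norm ?subr_ge0 // ler_norml; lra.
Qed.

End OneVariable.

(** * The contraction *)

Section EuclideanNorm.
Local Open Scope ring_scope.
Variables (F : realFieldType) (M : expansion F).
Hypothesis HC : definably_complete M.

(** By [sqrt_exists] a root exists, so [enorm] never falls back on its default value. *)
Lemma enormP n (v : 'rV[F]_n) :
  0 <= enorm v /\ enorm v ^+ 2 = \sum_(i < n) v ord0 i ^+ 2.
Proof.
have [|r r0 rv] := sqrt_exists HC (_ : 0 <= \sum_(i < n) v ord0 i ^+ 2).
  by apply: sumr_ge0 => i _; exact: sqr_ge0.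
pose isroot r := 0 <= r /\ r ^+ 2 = \sum_(i < n) v ord0 i ^+ 2.
exact: (@xgetPex _ 0 isroot (ex_intro _ r (conj r0 rv))).
Qed.

Lemma coord_le_enorm n (v : 'rV[F]_n) i : `|v ord0 i| <= enorm v.
Proof.
have [v0 vE] := enormP v; rewrite -(ler_pXn2r (n := 2)) ?nnegrE //.
rewrite vE real_normK ?num_real // (bigD1 i) //= lerDl.
by apply: sumr_ge0 => j _; exact: sqr_ge0.
Qed.

Lemma enorm_le_sum n (v : 'rV[F]_n) : enorm v <= \sum_(i < n) `|v ord0 i|.
Proof.
have [v0 vE] := enormP v; rewrite -(ler_pXn2r (n := 2)) ?nnegrE ?sumr_ge0 //.
rewrite vE {v0 vE}.
(* Comparing squares, the invariant carries [0 <= b] so that the cross terms arising from a sum are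
   nonnegative. *)
apply: (big_ind2 (fun a b => 0 <= b /\ a <= b ^+ 2) _ _ _).2 => /=.
- by rewrite expr0n.
- by move=> a b a' b' [? ?] [? ?]; split; nra.
- by move=> i _; rewrite real_normK ?num_real.
Qed.

End EuclideanNorm.

Lemma exists_uniform_pos (F : realFieldType) n (Q : 'I_n -> F -> Prop) :
  (forall i d e, Q i d -> (e <= d)%R -> Q i e) ->
  (forall i, exists2 d, (0 < d)%R & Q i d) ->
  exists2 d, (0 < d)%R & forall i, Q i d.
Proof.
move=> Qmono Qpos.
suff [d d0 dP] : exists2 d, (0 < d)%R & forall i, i \in enum 'I_n -> Q i d.
  by exists d => // i; apply: dP; rewrite mem_enum.
elim: (enum _) => [|i s [d d0 dP]]; first by exists 1%R.
have [e e0 eP] := Qpos i; exists (Num.min d e); first by rewrite lt_min d0.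
move=> j; rewrite inE => /predU1P[->|/dP jd].
  by apply: Qmono eP _; rewrite ge_min lexx orbT.
by apply: Qmono jd _; rewrite ge_min lexx.
Qed.

Lemma dist_min_le (F : realFieldType) (a b d : F) :
  (`|Num.min a d - Num.min b d| <= `|a - b|)%R.
Proof.
wlog ab : a b / (a <= b)%R => [hw|].
  by have [|/ltW] := leP a b => [|ba]; [|rewrite distrC [`|a - b|%R]distrC]; apply: hw.
rewrite distrC [`|a - b|%R]distrC [leRHS]ger0_norm ?subr_ge0 //.
by case: (leP a d) => ?; case: (leP b d) => ?; rewrite ger0_norm; lra.
Qed.

(** * The curve in [E] approaching [x] and its contraction *)

Section ShrinkingCurve.
Local Open Scope ring_scope.
Variables (F : realFieldType) (M : expansion F).
Hypotheses (HC : definably_complete M) (HO : locally_ominimal M).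
Variables (n : nat) (E : 'rV[F]_n -> Prop) (x : 'rV[F]_n).
Hypotheses (dE : definable M E) (nEx : ~ E x).
Hypothesis Ex : forall e : F, 0 < e -> exists2 y, E y & enorm (y - x) < e.

Implicit Types y z : 'rV[F]_n.

(** The l1 distance involves no root, so the definability calculus applies to it; by [rho_dist] it
    is Lipschitz for the Euclidean norm. *)
Let rho y : F := \sum_(i < n) `|y ord0 i - x ord0 i|.

Let coord_le_rho y i : `|y ord0 i - x ord0 i| <= rho y.
Proof. by rewrite /rho (bigD1 i) //= lerDl sumr_ge0. Qed.

Let rho_gt0 y : E y -> 0 < rho y.
Proof.
move=> Ey; rewrite lt_neqAle sumr_ge0 // andbT; apply/negP => /eqP rho0.
apply: nEx; suff -> : x = y by [].
apply/rowP => i; apply/esym/eqP; rewrite -subr_eq0 -normr_le0 rho0.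
exact: coord_le_rho.
Qed.

Let rho_dist y z : `|rho y - rho z| <= n%:R * enorm (y - z).
Proof.
rewrite /rho -sumrB; apply: le_trans (ler_norm_sum _ _ _) _.
rewrite mulr_natl -[X in _ *+ X](card_ord n) -sumr_const; apply: ler_sum => i _.
apply: le_trans (ler_dist_dist _ _) _.
by have := coord_le_enorm HC (y - z) i; rewrite !mxE opprB addrA subrK.
Qed.

(** Positive values of [rho] on [E] accumulate at 0, so by decidability they fill an interval to the
    right of 0; points realising them are chosen definably. *)
Let definable_curve : exists2 g : F -> 'rV[F]_n,
  (forall i, dfun M (@coord1 F) (fun t => g t ord0 i)) &
  near_right 0 (fun t => E (g t) /\ rho (g t) = t).
Proof.
have [|g dg gP] := @definable_choice _ _ HC HO n _ _ (@coord1 F)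
    (fun t y => E y /\ rho y = t).
  by rewrite /rho; dfn.
exists g => //.
have [|rE|[d d0 dP]] := @definable_right_decided _ _ HO (fun t => exists y, E y /\ rho y = t) 0.
- by rewrite /rho; dfn.
- apply: near_right_imp rE => t _ Et; apply: gP => //.
  (* Definable choice asks for a lower bound on the coordinates: [rho y = t] forces each
     [y ord0 i >= x ord0 i - t]. *)
  exists (- t - \sum_(i < n) `|x ord0 i|) => y i [_ yt].
  have := coord_le_rho y i; rewrite yt ler_norml => /andP[+ _].
  suff: - x ord0 i <= \sum_(i < n) `|x ord0 i| by lra.
  rewrite (bigD1 i) //= -[leLHS]addr0 lerD ?sumr_ge0 //.
  by rewrite -normrN ler_norm.
(* The bound gives [rho y <= n%:R * enorm (y - x) < d]; dividing by [n.+1] also covers [n = 0]. *)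
exfalso; have [|y Ey yx] := Ex (_ : 0 < d / n.+1%:R); first by rewrite divr_gt0.
apply: (dP (rho y) (rho_gt0 Ey)); last by exists y.
have := rho_dist y x; have -> : rho x = 0 by rewrite /rho big1 // => i _; rewrite subrr normr0.
rewrite subr0 add0r; move/(le_trans (ler_norm _)) => /le_lt_trans; apply.
move: yx; rewrite ltr_pdivlMr // mulrC; apply: le_lt_trans.
by rewrite ler_wpM2r ?ler_nat //; case: (enormP HC (y - x)).
Qed.

Lemma contraction_without_fixpoint : ~ BFPP M E.
Proof.
have [g dg gP] := definable_curve => bE.
have [||d d0 gL] := @exists_uniform_pos F n (fun i d => forall s t,
    0 < s -> s < d -> 0 < t -> t < d ->
    `|g s ord0 i - g t ord0 i| <= 2 * `|s - t|).
- by move=> i d e dP ed s t s0 se t0 te; apply: dP => //; lra.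
(* Subtracting [x ord0 i] makes the coordinate bounded by [rho (g t) = t]; differences do not
   change. *)
- move=> i; have [||d d0 dP] := @near_right_lipschitz _ _ HC HO
    (fun t => g t ord0 i - x ord0 i).
  + by dfn.
  + by apply: near_right_imp gP => t _ [_ {2}<-]; exact: coord_le_rho.
  exists d => // s t s0 sd t0 td; have := dP s t s0 sd t0 td.
  by rewrite opprB addrA subrK.
case: gP => r r0 gP; rewrite add0r in gP.
(* Each of the [n] coordinates contributes [2 * k * n%:R * enorm (y - z)], so the contraction
   constant is [2 * n%:R ^+ 2 * k], which this [k] makes less than 1. It also gives [k < 1], whence
   [s y < rho y]. *)
pose k : F := (2 * n%:R ^+ 2 + 2)^-1.
have n20 : 0 <= n%:R ^+ 2 :> F by rewrite exprn_ge0.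
have k0 : 0 < k by rewrite invr_gt0; lra.
have kE : k * (2 * n%:R ^+ 2 + 2) = 1 by rewrite mulVf // gt_eqF //; lra.
have k1 : k < 1 by nra.
pose m := Num.min d r; have m0 : 0 < m by rewrite lt_min d0.
pose s y := k * Num.min (rho y) m.
have sP y : E y -> [/\ 0 < s y, s y < d, s y < r & s y < rho y].
  move=> /rho_gt0 y0; have min0 : 0 < Num.min (rho y) m by rewrite lt_min y0.
  have : s y < Num.min (rho y) m by rewrite /s gtr_pMl.
  rewrite !lt_min => /andP[? /andP[? ?]]; split=> //; exact: mulr_gt0.
(* A fixed point would satisfy [rho y = rho (g (s y)) = s y < rho y]. *)
have [|y Ey /(congr1 rho)] := bE (fun y => g (s y)); last first.
  have [s0 _ sr srho] := sP y Ey; have [_ ->] := gP _ s0 sr.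
  by move=> srE; rewrite srE ltxx in srho.
split; last first.
  exists (2 * n%:R ^+ 2 * k); split.
  - by rewrite !mulr_ge0 // ltW.
  - nra.
  move=> y z Ey Ez; apply: le_trans (enorm_le_sum HC _) _.
  have szy : `|s y - s z| <= k * (n%:R * enorm (y - z)).
    rewrite /s -mulrBr normrM gtr0_norm // ler_pM2l //.
    exact: le_trans (dist_min_le _ _ _) (rho_dist _ _).
  have [? ? _ _] := sP y Ey; have [? ? _ _] := sP z Ez.
  apply: (@le_trans _ _ (\sum_(i < n) 2 * (k * (n%:R * enorm (y - z))))).
    apply: ler_sum => i _; rewrite !mxE.
    by apply: le_trans (gL i _ _ _ _ _ _) _ => //; rewrite ler_pM2l.
  rewrite sumr_const card_ord -mulr_natl le_eqVlt; apply/orP; left; apply/eqP; ring.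
split=> [y Ey|].
  by have [s0 _ sr _] := sP y Ey; case: (gP _ s0 sr).
have [f fP] : dpred M (fun p : 'rV[F]_(n + n) => p) (fun p =>
    E (lsubmx p) /\ forall i, rsubmx p ord0 i = g (s (lsubmx p)) ord0 i).
  have dl i : dfun M (fun p : 'rV[F]_(n + n) => p) (fun p => lsubmx p ord0 i).
    by under [X in dfun _ _ X]funext do rewrite mxE; dfn.
  have dr i : dfun M (fun p : 'rV[F]_(n + n) => p) (fun p => rsubmx p ord0 i).
    by under [X in dfun _ _ X]funext do rewrite mxE; dfn.
  dfn; first exact: dl; first exact: dr.
  by apply: (dfun_comp1 (dg _)); rewrite /s /rho; dfn; exact: dl.
exists f; apply/funext => p; apply/propext; rewrite -fP /=.
by split=> -[Ez zE]; split=> //; [move=> i; rewrite zE | apply/rowP].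
Qed.

End ShrinkingCurve.

Theorem theorem1p1 (F : realFieldType) (M : expansion F)
    (HC : definably_complete M) (HO : locally_ominimal M) :
  strong_BFPP M.
Proof.
move=> n E dE bE x nEx; apply: contrapT => nE.
apply: (contraction_without_fixpoint HC HO dE nEx) bE => e e0.
apply: contrapT => nEe; apply: nE; exists e => // y ye Ey.
by apply: nEe; exists y.
Qed.
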